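(* For every compact abelian group $G$ and every finite set $D\subset G\setminus\{0\}$ with $|D|\le 3$, the Motzkin density $\mathrm{Md}_G(D)$ is a rational number.
   Context: Compact abelian groups are Hausdorff; $\mu$ denotes the Haar probability measure on $G$. For $D\subset G$, a set $A\subset G$ is $D$-avoiding if $(A-A)\cap D=\emptyset$. The Motzkin density is $\mathrm{Md}_G(D)=\sup\{\mu(A): A\subset G \text{ Borel},\ (A-A)\cap D=\emptyset\}$. *)

(* Defs.v *)
From HB Require Import structures.
From mathcomp Require Import all_boot all_order all_algebra.
From mathcomp Require Import all_classical all_reals all_analysis.
Set Implicit Arguments. Unset Strict Implicit. Unset Printing Implicit Defensive.
Import Order.TTheory GRing.Theory Num.Theory.
Local Open Scope classical_set_scope.
Local Open Scope ring_scope.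

Section BorelType.
Variable G : topologicalZmodType.
Definition borel_carrier : Type := G.
HB.instance Definition _ := Choice.on borel_carrier.
HB.instance Definition _ := isPointed.Build borel_carrier 0.
Definition borel_sets : set (set borel_carrier) := @open G.
HB.instance Definition _ :=
  Measurable.copy borel_carrier (g_sigma_algebraType borel_sets).
End BorelType.
Notation borel G := (borel_carrier G).
Lemma borel_measurableE (G : topologicalZmodType) :
  (measurable : set (set (borel G))) = <<s (@open G) >>.
Proof. by []. Qed.

Definition is_haar_prob (G : topologicalZmodType) (R : realType)
  (mu : probability (borel G) R) : Prop :=
  (forall (x : G) (A : set G), measurable (A : set (borel G)) ->
     mu ((fun y => x + y) @` A) = mu A) /\
  (forall A : set G, measurable (A : set (borel G)) ->
     mu A = ereal_sup [set mu K | K in [set K : set G | compact K /\ K `<=` A]]) /\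
  (forall A : set G, measurable (A : set (borel G)) ->
     mu A = ereal_inf [set mu U | U in [set U : set G | open U /\ A `<=` U]]).

Definition avoiding (G : zmodType) (D A : set G) : Prop :=
  forall a b, A a -> A b -> ~ D (a - b).

Definition motzkin_density (G : topologicalZmodType) (R : realType)
  (mu : probability (borel G) R) (D : set G) : \bar R :=
  ereal_sup [set mu A | A in [set A : set G |
                 measurable (A : set (borel G)) /\ avoiding D A]].

(* Main.v *)
Require Import Defs.
From HB Require Import structures.
From mathcomp Require Import all_boot all_order all_algebra.
From mathcomp Require Import zify ring lra.
From mathcomp Require Import all_classical all_reals all_analysis.
From mathcomp Require Import measurable_realfun.
Set Implicit Arguments. Unset Strict Implicit. Unset Printing Implicit Defensive.
Import Order.TTheory GRing.Theory Num.Theory.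
Local Open Scope classical_set_scope.
Local Open Scope ring_scope.

(** Let H be the subgroup generated by D = {d1, d2, d3}.  The Motzkin density
    only depends on the Cayley graph of H.  A bound on the number of elements
    that an avoiding set can have among finitely many translates integrates to
    an upper bound for its measure.  Conversely, avoiding sets of H are
    transplanted to G by region growing: by compactness G is covered by finitely
    many open sets C whose translates by a large ball of H are disjoint; around
    each point of C one keeps a ball whose boundary layer is small (possible
    since H has polynomial growth), fills it with a translate of the avoiding
    set, discards the layer, and goes on with the rest of G.

    It remains to see that the independence density of H is rational.  If all
    integer relations between d1, d2, d3 are multiples of one relation v, then H
    maps onto the cycle of length N = |v|_1 and also contains a closed walk of
    length N, so the density is floor(N/2)/N (with N = 2 if there is no
    relation).  Otherwise H is finite, where the density is a maximum, or
    virtually cyclic, where it is the maximal mean weight of a cycle in a finite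
    graph of states. *)

(** * Cycles of maximal mean weight *)

Lemma nonuniq_uniq_loop (T : eqType) (s : seq T) : ~~ uniq s ->
  exists s1 y s2 s3, s = s1 ++ (y :: s2) ++ (y :: s3) /\ uniq (y :: s2).
Proof.
elim: s => //= a s IH; rewrite negb_and negbK.
have [us|/IH[s1 [y [s2 [s3 [-> u]]]]] _] := boolP (uniq s); last first.
  by exists (a :: s1), y, s2, s3.
rewrite orbF => /path.splitPr sE; case: sE us => s2 s3 us.
exists [::], a, s2, s3; split=> //.
move: us; rewrite cat_uniq /= negb_or => /and3P[-> /andP[-> _] _] //.
Qed.

(** A walk splits into simple cycles and a simple remainder. The cycles have mean weight at most
    that of [c], and the remainder weighs at most the total weight of [T], whence [C]. The loop at
    [x0] ensures that some cycle exists. *)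
Lemma max_mean_cycle (T : finType) (e : rel T) (w : T -> nat) (x0 : T) :
  e x0 x0 ->
  exists (c : seq T) (C : nat), [/\ c != [::], cycle e c &
    forall x p, path e x p ->
      ((\sum_(y <- x :: p) w y) * size c <=
       (\sum_(y <- c) w y) * size (x :: p) + C)%N].
Proof.
move=> ex0.
pose W := (\sum_(y : T) w y)%N.
pose wt (s : seq T) := (\sum_(y <- s) w y)%N.
have wle s : uniq s -> (wt s <= W)%N.
  move=> us; rewrite /wt /W [leqRHS](bigID (mem s)) /= (big_uniq _ us).
  exact: leq_addr.
have sle (s : seq T) : uniq s -> (size s <= #|T|)%N.
  by move=> us; rewrite -(card_uniqP us) max_card.
(* Only weight and length of a cycle are recorded, within bounds that every simple cycle meets, so
   the best quotient is a maximum over a finite type. *)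
pose real (i : 'I_W.+1 * 'I_#|T|.+1) := `[< exists c, [/\ c != [::], cycle e c,
   wt c = i.1 & size c = i.2] >].
have T0 : (1 <= #|T|)%N by rewrite (sle [:: x0]).
have w0 : (wt [:: x0] < W.+1)%N by rewrite ltnS wle.
pose i0 : 'I_W.+1 * 'I_#|T|.+1 := (Ordinal w0, inord 1).
have ri0 : real i0.
  apply/asboolP; exists [:: x0]; split=> //=; first by rewrite ex0.
  by rewrite inordK.
pose rho (i : 'I_W.+1 * 'I_#|T|.+1) : rat := i.1%:R / i.2%:R.
case: (@arg_maxP _ _ _ i0 real rho ri0) => i /asboolP[c [c0 cc ci1 ci2]] imax.
have cmax s : s != [::] -> uniq s -> cycle e s ->
    (wt s * size c <= wt c * size s)%N.
  move=> s0 us cs.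
  have s1 : (wt s < W.+1)%N by rewrite ltnS wle.
  have s2 : (size s < #|T|.+1)%N by rewrite ltnS sle.
  have /imax : real (Ordinal s1, Ordinal s2) by apply/asboolP; exists s.
  rewrite /rho /= ler_pdivrMr; last first.
    by rewrite ltr0n lt0n size_eq0.
  rewrite mulrAC ler_pdivlMr; last by rewrite -ci2 ltr0n lt0n size_eq0.
  by rewrite -ci1 -ci2 -!natrM ler_nat.
exists c, (W * size c)%N; split=> // x p.
rewrite -/(wt _) -/(wt _).
have [k] := ubnP (size (x :: p)).
elim: k x p => // k IH x p; rewrite ltnS => szp pp.
have [u|/nonuniq_uniq_loop[s1 [y [s2 [s3 [E u]]]]]] := boolP (uniq (x :: p)).
  by rewrite (leq_trans _ (leq_addl _ _)) // leq_mul2r wle // orbT.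
have sE : sorted e (s1 ++ (y :: s2) ++ (y :: s3)) by rewrite -E.
have cs : cycle e (y :: s2).
  move: sE; rewrite sorted_cat_cons => /andP[_] /=.
  by rewrite cat_path rcons_path /= => /and3P[-> ->].
have sE' : sorted e (s1 ++ y :: s3).
  move: sE; rewrite !sorted_cat_cons => /andP[->] /=.
  by rewrite cat_path /= => /and3P[].
have le1 := cmax (y :: s2) isT u cs.
have wtE : wt (x :: p) = (wt (y :: s2) + wt (s1 ++ y :: s3))%N.
  by rewrite E /wt !big_cat /= addnCA.
have szE : size (x :: p) = (size (y :: s2) + size (s1 ++ y :: s3))%N.
  by rewrite E !size_cat addnCA.
case F : (s1 ++ y :: s3) sE' => [|x' p'] sE'; first by case: (s1) F.
have le2 : (wt (x' :: p') * size c <= wt c * size (x' :: p') + W * size c)%N.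
  by apply: IH sE'; rewrite -F (leq_trans _ szp) // szE /= addSn ltnS leq_addl.
rewrite wtE szE F mulnDl mulnDr -addnA; exact: leq_add.
Qed.

(** * Extremal families of translates *)

Definition ind (G : Type) (A : set G) (x : G) : nat := `[< A x >].

Lemma ind_mono (G G' : Type) (A : set G) (B : set G') x y :
  (A x -> B y) -> (ind A x <= ind B y)%N.
Proof. by rewrite /ind; do 2 case: asboolP => //=; move=> nb a /(_ a). Qed.

Lemma ind_eq (G G' : Type) (A : set G) (B : set G') x y :
  (A x <-> B y) -> ind A x = ind B y.
Proof. by case=> AB BA; apply/eqP; rewrite eqn_leq !ind_mono. Qed.

(** * Sums along arithmetic progressions *)

Section PeriodSum.
Variable G : zmodType.
Implicit Types (d t x : G) (f : G -> nat).

Definition period_sum d N f x := (\sum_(0 <= i < N) f (x + d *+ i)%R)%N.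

Lemma period_sum_invariant d N f : (forall x, f (x + d *+ N) = f x) ->
  forall x, period_sum d N f (x + d) = period_sum d N f x.
Proof.
case: N => [|n] fN x; rewrite /period_sum; first by rewrite !big_geq.
rewrite big_nat_recr //= [RHS]big_nat_recl //= addnC.
rewrite -addrA -mulrS fN addr0; congr addn.
by apply: eq_bigr => i _; rewrite mulrS addrA.
Qed.

Lemma period_sum_keeps_invariance d N f t : (forall x, f (x + t) = f x) ->
  forall x, period_sum d N f (x + t) = period_sum d N f x.
Proof. by move=> ft x; apply: eq_bigr => i _; rewrite addrAC ft. Qed.

Lemma invariant_intmul f t : (forall x, f (x + t) = f x) ->
  forall (z : int) x, f (x + t *~ z) = f x.
Proof.
move=> ft; elim/int_ind => [|n IH|n IH] x.
- by rewrite mulr0z addr0.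
- by rewrite intS mulrzDr mulr1z addrA IH ft.
- by rewrite intS opprD mulrzDr mulrNz mulr1z addrA IH -[LHS]ft subrK.
Qed.

(** Kept as a list: coinciding elements count with multiplicity, so the size is always a product. *)
Definition dilate (gs : seq G) d N :=
  [seq g + d *+ i | g <- gs, i <- index_iota 0 N].

Lemma size_dilate gs d N : size (dilate gs d N) = (size gs * N)%N.
Proof. by rewrite size_allpairs size_iota subn0. Qed.

Lemma sum_dilate gs d N f x :
  (\sum_(g <- dilate gs d N) f (x + g)%R =
   \sum_(g <- gs) period_sum d N f (x + g)%R)%N.
Proof.
rewrite /dilate big_allpairs_dep; apply: eq_bigr => g _.
by apply: eq_bigr => i _; rewrite addrA.
Qed.
End PeriodSum.

(* The ratio c / size gs is then the best density: P reaches it on every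
   translate of gs by H, and no avoiding set exceeds it asymptotically. *)
Definition extremal (G : zmodType) (D H : set G) : Prop :=
  exists (gs : seq G) (c C : nat), [/\ (0 < size gs)%N,
    exists2 P, avoiding D P &
      forall h, H h -> (c <= \sum_(g <- gs) ind P (h + g)%R)%N &
    forall L, exists gs', (L <= size gs')%N /\ forall A, avoiding D A ->
      ((\sum_(g <- gs') ind A g) * size gs <= c * size gs' + C)%N].

(** Repeating [gs'] provides arbitrarily long families without additive error. *)
Lemma extremal_of_exact (G : zmodType) (D H : set G) gs gs' c :
  (0 < size gs)%N -> size gs' = size gs ->
  (exists2 P, avoiding D P &
      forall h, H h -> (c <= \sum_(g <- gs) ind P (h + g)%R)%N) ->
  (forall A, avoiding D A -> (\sum_(g <- gs') ind A g <= c)%N) ->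
  extremal D H.
Proof.
move=> gs0 sz cov pack; exists gs, c, 0%N; split=> // L.
exists (flatten (nseq L gs')).
have szL : size (flatten (nseq L gs')) = (L * size gs)%N.
  by rewrite size_flatten /shape map_nseq sumn_nseq sz mulnC.
split=> [|A /pack le]; first by rewrite szL leq_pmulr.
have -> : (\sum_(g <- flatten (nseq L gs')) ind A g =
           L * \sum_(g <- gs') ind A g)%N.
  by elim: (L) => [|l IH] /=; rewrite ?big_nil // big_cat IH mulSn.
by rewrite szL addn0 mulnA [(c * _)%N]mulnC leq_mul2r leq_mul2l le !orbT.
Qed.

(** * Integer combinations of three generators *)

Section Lin3.
Variables (G : zmodType) (d1 d2 d3 : G).

Definition lin3 (i j k : int) : G := d1 *~ i + d2 *~ j + d3 *~ k.

Lemma lin3D i j k i' j' k' :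
  lin3 i j k + lin3 i' j' k' = lin3 (i + i') (j + j') (k + k').
Proof. by rewrite /lin3 !mulrzDr addrACA; congr (_ + _); rewrite addrACA. Qed.

Lemma lin3N i j k : - lin3 i j k = lin3 (- i) (- j) (- k).
Proof. by rewrite /lin3 !opprD !mulrNz. Qed.

Lemma lin3B i j k i' j' k' :
  lin3 i j k - lin3 i' j' k' = lin3 (i - i') (j - j') (k - k').
Proof. by rewrite lin3N lin3D. Qed.

Lemma lin3M i j k l : lin3 i j k *~ l = lin3 (i * l) (j * l) (k * l).
Proof. by rewrite /lin3 !mulrzDl !mulrzA. Qed.

Lemma lin3_1 z : d1 *~ z = lin3 z 0 0.
Proof. by rewrite /lin3 !mulr0z !addr0. Qed.

Lemma lin3_2 z : d2 *~ z = lin3 0 z 0.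
Proof. by rewrite /lin3 !mulr0z addr0 add0r. Qed.

Lemma lin3_3 z : d3 *~ z = lin3 0 0 z.
Proof. by rewrite /lin3 !mulr0z !add0r. Qed.

Definition span3 : set G := [set x | exists i j k : int, x = lin3 i j k].
End Lin3.

Definition set3 (G : zmodType) (d1 d2 d3 : G) : set G :=
  [set x | x \in [:: d1; d2; d3]].

Lemma avoiding_shift (G : zmodType) (D A : set G) x :
  avoiding D A -> avoiding D [set y | A (x + y)].
Proof. by move=> av a b /= Aa Ab; have := av _ _ Aa Ab; rewrite opprD addrACA subrr add0r. Qed.

(** Consecutive vertices of the walk never both lie in [A]. Summed over the edges, this counts each
    vertex of a closed walk twice, as a tail and as a head. *)
Lemma closed_walk_packing (G : zmodType) (D A : set G) (steps : seq G) :
  (forall s, s \in steps -> D s \/ D (- s)) -> \sum_(s <- steps) s = 0 ->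
  avoiding D A ->
  (\sum_(g <- scanl +%R 0%R steps) ind A g <= (size steps)./2)%N.
Proof.
move=> stD sum0 av.
have last_scanl x : last x (scanl +%R x steps) = x + \sum_(s <- steps) s.
  elim: (steps) x => [|s ss IH] x /=; first by rewrite big_nil addr0.
  by rewrite IH big_cons addrA.
have walk x ss : (forall s, s \in ss -> D s \/ D (- s)) ->
    (\sum_(g <- belast x (scanl +%R x ss)) ind A g +
     \sum_(g <- scanl +%R x ss) ind A g <= size ss)%N.
  elim: ss x => [|s ss IH] x sD /=; first by rewrite big_nil.
  rewrite !big_cons addnACA -[(size ss).+1]add1n; apply: leq_add; last first.
    by apply: IH => y ys; apply: sD; rewrite inE ys orbT.
  rewrite /ind; do 2 case: asboolP => //=; move=> Ay Ax.
  case: (sD s (mem_head _ _)) => Ds; exfalso.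
    by apply: (av _ _ Ay Ax); rewrite addrC addKr.
  by apply: (av _ _ Ax Ay); rewrite opprD addrA subrr add0r.
have := walk 0 _ stD.
have E : (\sum_(g <- 0%R :: scanl +%R 0%R steps) ind A g =
          \sum_(g <- rcons (belast 0%R (scanl +%R 0%R steps)) 0%R) ind A g)%N.
  by rewrite [in LHS]lastI last_scanl sum0 addr0.
move: E; rewrite big_cons big_rcons /= [in RHS]addnC => /addnI <-.
by rewrite addnn => /half_leq; rewrite doubleK.
Qed.

(** * Relations of rank at most one, and torsion *)

(** A maximum independent set of the cycle of length [N], lifted to the integers. The bound
    [r.+1 < N] leaves out [N - 1], which is even for odd [N] and adjacent to 0. *)
Definition even_residues (N : nat) : set int :=
  [set z | exists r : nat, [/\ ~~ odd r, (r.+1 < N)%N & (N %| z - r%:Z)%Z]].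

Lemma even_residues_avoid_unit N (y z s : int) :
  s = 1 \/ s = -1 -> even_residues N y -> even_residues N z ->
  ~ (N %| y - z - s)%Z.
Proof.
move=> s1 [r [er rN Ny]] [r' [er' rN' Nz]] Nyz.
have : (N %| r%:Z - r'%:Z - s)%Z.
  have -> : r%:Z - r'%:Z - s = (y - z - s) - (y - r%:Z) + (z - r'%:Z) by ring.
  by rewrite rpredD // rpredB.
case/dvdzP => q qE.
(* Both residues are at most [N - 2], so this multiple of [N] is below [N] in absolute value; parity
   then rules out 0. *)
have q0 : q = 0 by case: s1 qE => ->; nia.
by move: qE er er'; rewrite q0 mul0r; case: s1 => ->; lia.
Qed.

(** Periodicity moves the window to start at 0, where the even [k < N - 1] are counted. *)
Lemma even_residues_window N (z : int) : (1 < N)%N ->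
  (N./2 <= \sum_(0 <= k < N) ind (even_residues N) (z + k%:Z)%R)%N.
Proof.
move=> N1.
have per y : ind (even_residues N) (y + 1 *+ N) = ind (even_residues N) y.
  have NN : (N %| (1 *+ N)%R)%Z by rewrite natz.
  apply: ind_eq; split=> -[r [er rN Ny]]; exists r; split=> //.
    by rewrite -[y](addrK (1 *+ N)) addrAC (rpredB Ny NN).
  by rewrite addrAC (rpredD Ny NN).
have E x : (\sum_(0 <= k < N) ind (even_residues N) (x + k%:Z)%R =
    period_sum 1 N (ind (even_residues N)) x)%N.
  by apply: eq_bigr => k _; rewrite natz.
have /invariant_intmul/(_ z 0) := period_sum_invariant per.
rewrite add0r intz E => ->; rewrite -E.
case: N N1 {per E} => // M M0.
have -> : M.+1./2 = (\sum_(0 <= k < M) ~~ odd k)%N.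
  elim: M {M0} => [|M IH]; first by rewrite big_geq.
  by rewrite big_nat_recr //= -IH; lia.
rewrite big_nat_recr //= (leq_trans _ (leq_addr _ _)) //.
rewrite big_nat_cond [leqRHS]big_nat_cond; apply: leq_sum => k.
rewrite andbT => /andP[_ kM].
have [ok|ek] := boolP (odd k) => //.
rewrite /ind; case: asboolP => // -[]; exists k; split=> //.
by rewrite add0r subrr.
Qed.

(** The form [s1 * i + s2 * j + s3 * k] descends to a homomorphism from the span to the integers
    modulo [size steps] that sends each generator to 1 or -1. Pulling back [even_residues] gives the
    set; the closed walk gives the matching bound. *)
Lemma extremal_of_cycle (G : zmodType) (d1 d2 d3 : G) (s1 s2 s3 : int)
    (steps : seq G) :
  (1 < size steps)%N ->
  s1 = 1 \/ s1 = -1 -> s2 = 1 \/ s2 = -1 -> s3 = 1 \/ s3 = -1 ->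
  (forall i j k : int, lin3 d1 d2 d3 i j k = 0 ->
     (size steps %| s1 * i + s2 * j + s3 * k)%Z) ->
  (forall s, s \in steps -> set3 d1 d2 d3 s \/ set3 d1 d2 d3 (- s)) ->
  \sum_(s <- steps) s = 0 ->
  extremal (set3 d1 d2 d3) (span3 d1 d2 d3).
Proof.
set N := size steps => N1 h1 h2 h3 rel stD sum0.
(* Along [gs] the form takes [N] consecutive values, as [s1 * s1 = 1]. *)
pose gs := [seq d1 *~ (s1 * k%:Z) | k <- index_iota 0 N].
apply: (@extremal_of_exact _ _ _ gs (scanl +%R 0 steps) N./2).
- by rewrite size_map size_iota subn0 ltnW.
- by rewrite size_scanl size_map size_iota subn0.
- exists [set x | exists i j k : int, x = lin3 d1 d2 d3 i j k /\
             even_residues N (s1 * i + s2 * j + s3 * k)].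
    move=> _ _ [i [j [k [-> e]]]] [i' [j' [k' [-> e']]]].
    have key (a b c : int) :
        lin3 d1 d2 d3 i j k - lin3 d1 d2 d3 i' j' k' = lin3 d1 d2 d3 a b c ->
        (N %| (s1 * i + s2 * j + s3 * k) - (s1 * i' + s2 * j' + s3 * k') -
              (s1 * a + s2 * b + s3 * c))%Z.
      move/eqP; rewrite -subr_eq0 !lin3B => /eqP/rel.
      by congr (_ %| _)%Z; ring.
    rewrite /set3 /= !inE => /or3P[] /eqP E; move: E.
    + rewrite -[d1 in RHS]mulr1z (lin3_1 d1 d2 d3) => /key.
      by rewrite mulr1 !mulr0 !addr0; exact: even_residues_avoid_unit.
    + rewrite -[d2 in RHS]mulr1z (lin3_2 d1 d2 d3) => /key.
      by rewrite mulr1 !mulr0 addr0 add0r; exact: even_residues_avoid_unit.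
    + rewrite -[d3 in RHS]mulr1z (lin3_3 d1 d2 d3) => /key.
      by rewrite mulr1 !mulr0 !add0r; exact: even_residues_avoid_unit.
  move=> _ [i [j [k ->]]].
  apply: leq_trans (even_residues_window (s1 * i + s2 * j + s3 * k) N1) _.
  rewrite big_map; apply: leq_sum => l _; apply: ind_mono => e.
  exists (i + s1 * l%:Z), j, k; split.
    by rewrite (lin3_1 d1 d2 d3) lin3D !addr0.
  suff -> : s1 * (i + s1 * l%:Z) + s2 * j + s3 * k =
     s1 * i + s2 * j + s3 * k + l%:Z by [].
  have ss : s1 * s1 = 1 by case: h1 => ->.
  by rewrite mulrDr mulrA ss; ring.
- by move=> A; exact: closed_walk_packing.
Qed.

Section Box.
Variables (G : zmodType) (d1 d2 d3 : G).
Implicit Types (n N : nat) (f : G -> nat).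

Definition box n : seq G := dilate (dilate (dilate [:: 0] d1 n) d2 n) d3 n.

Lemma size_box n : size (box n) = (n ^ 3)%N.
Proof. by rewrite !size_dilate mul1n !expnS muln1 mulnA. Qed.

Lemma sum_box n f x : (\sum_(g <- box n) f (x + g)%R =
  period_sum d1 n (period_sum d2 n (period_sum d3 n f)) x)%N.
Proof. by rewrite !sum_dilate big_seq1 addr0. Qed.

Lemma sum_box_invariant n f :
  (forall x, f (x + d1 *+ n) = f x) -> (forall x, f (x + d2 *+ n) = f x) ->
  (forall x, f (x + d3 *+ n) = f x) -> forall h, span3 d1 d2 d3 h ->
  (\sum_(g <- box n) f (h + g)%R = \sum_(g <- box n) f g)%N.
Proof.
move=> f1 f2 f3 _ [i [j [k ->]]].
transitivity (\sum_(g <- box n) f (0 + g)%R)%N; last first.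
  by apply: eq_bigr => g _; rewrite add0r.
rewrite !sum_box /lin3 -[in LHS](add0r (_ *~ i)) !invariant_intmul //.
- by apply: period_sum_invariant; do 2 apply: period_sum_keeps_invariance.
- by apply: period_sum_keeps_invariance; apply: period_sum_invariant;
    apply: period_sum_keeps_invariance.
- by do 2 apply: period_sum_keeps_invariance; apply: period_sum_invariant.
Qed.

(** An avoiding set with the most points in [box N], counted with multiplicity, has the same count
    on every translate of the box by the span; its maximality is the packing bound. *)
Lemma extremal_of_torsion N : (0 < N)%N ->
  d1 *+ N = 0 -> d2 *+ N = 0 -> d3 *+ N = 0 ->
  extremal (set3 d1 d2 d3) (span3 d1 d2 d3).
Proof.
move=> N0 t1 t2 t3.
pose attained c := `[< exists2 P, avoiding (set3 d1 d2 d3) P &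
  (\sum_(g <- box N) ind P g)%N = c >].
have ex : exists c, attained c.
  exists (\sum_(g <- box N) ind (@set0 G) g)%N; apply/asboolP.
  by exists set0 => // a b [].
have bd c : attained c -> (c <= size (box N))%N.
  move=> /asboolP[P _ <-]; rewrite -sum1_size; apply: leq_sum => g _.
  by rewrite /ind; case: asboolP.
case: (ex_maxnP ex bd) => c /asboolP[P avP cE] cmax.
apply: (@extremal_of_exact _ _ _ (box N) (box N) c) => //.
- by rewrite size_box expn_gt0 N0.
- exists P => // h Hh; rewrite sum_box_invariant ?cE // => x.
  + by rewrite t1 addr0.
  + by rewrite t2 addr0.
  + by rewrite t3 addr0.
- by move=> A avA; apply: cmax; apply/asboolP; exists A.
Qed.
End Box.

(** * Virtually cyclic groups *)

Section States.
Variables (G : zmodType) (gl : seq G) (D : set G) (t : G).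
Let T := {ffun 'I_(size gl) -> bool}.

Definition state (A : set G) : T := [ffun i => `[< A gl`_(i : 'I__) >]].

(** A transfer matrix: consecutive states are traces of one avoiding set on [gl] and [t + gl], so an
    edge encodes all constraints within and between these blocks. *)
Definition succ_state : rel T := fun x y =>
  `[< exists2 A, avoiding D A & state A = x /\ state [set g | A (t + g)] = y >].

Definition state_weight (x : T) : nat := (\sum_i x i)%N.

Lemma state_weightE A : state_weight (state A) = (\sum_(g <- gl) ind A g)%N.
Proof.
rewrite (big_nth 0) big_mkord; apply: eq_bigr => i _.
by rewrite ffunE.
Qed.

Lemma path_states A k m : avoiding D A ->
  path succ_state (state [set g | A (t *+ k + g)])
    [seq state [set g | A (t *+ l + g)] | l <- iota k.+1 m].
Proof.
move=> avA; elim: m k => //= m IH k; rewrite {}IH andbT.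
apply/asboolP; exists [set g | A (t *+ k + g)]; first exact: avoiding_shift.
split=> //; congr state; apply/seteqP.
by split=> g /=; rewrite addrA mulrS [t + _]addrC.
Qed.

(* A bi-infinite walk of states glues to a single avoiding set as soon as the
   differences in D only connect cells in the same or in neighbouring blocks. *)
Variables (sig : int -> T).
Hypothesis sigS : forall z, succ_state (sig z) (sig (z + 1)).
Hypothesis block_unique : forall i j z z',
  gl`_i + t *~ z = gl`_j + t *~ z' -> (i < size gl)%N -> (j < size gl)%N ->
  z = z'.
Hypothesis D_local : forall (i j : nat) z z',
  (i < size gl)%N -> (j < size gl)%N ->
  D ((gl`_i + t *~ z) - (gl`_j + t *~ z')) ->
  [\/ z = z', z = z' + 1 | z' = z + 1].

Definition glued : set G :=
  [set x | exists (i : 'I_(size gl)) (z : int), x = gl`_i + t *~ z /\ sig z i].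

Lemma gluedE (i : 'I_(size gl)) z : glued (gl`_i + t *~ z) <-> sig z i.
Proof.
split; last by move=> s; exists i, z.
case=> j [z' [E s]]; have zz := block_unique E (ltn_ord _) (ltn_ord _).
rewrite -zz in E s; move/addIr: E => E.
(* Cells [i] and [j] may name the same element; [sig z] is the state of an actual set, so it agrees
   on them. *)
have /asboolP[A _ [As _]] := sigS z.
by move: s; rewrite -As !ffunE E.
Qed.

Lemma glued_avoiding : avoiding D glued.
Proof.
move=> _ _ [i [z [-> si]]] [j [z' [-> sj]]] Dij.
have step (k l : 'I_(size gl)) y : sig y k -> sig (y + 1) l ->
    exists2 A, avoiding D A & A gl`_k /\ A (gl`_l + t).
  have /asboolP[A avA [<- <-]] := sigS y.
  by rewrite !ffunE addrC => /asboolP Ak /asboolP Al; exists A.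
case: (D_local (ltn_ord _) (ltn_ord _) Dij) => E.
- rewrite E opprD addrACA subrr addr0 in Dij.
  have /asboolP[A avA [As _]] := sigS z.
  apply: (avA _ _ _ _ Dij).
    by move: si; rewrite -As ffunE => /asboolP.
  by move: sj; rewrite -E -As ffunE => /asboolP.
- rewrite E in si Dij; have [A avA [Aj Ai]] := step _ _ _ sj si.
  apply: (avA _ _ Ai Aj); move: Dij.
  by rewrite mulrzDr mulr1z [t *~ z' + t]addrC addrA opprD addrACA subrr addr0.
- rewrite E in sj Dij; have [A avA [Ai Aj]] := step _ _ _ si sj.
  apply: (avA _ _ Ai Aj); move: Dij.
  by rewrite mulrzDr mulr1z [t *~ z + t]addrC addrA opprD addrACA subrr addr0.
Qed.
End States.

Lemma cycle_walk (T : Type) (e : rel T) (c : seq T) x0 : cycle e c ->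
  c <> [::] -> forall z : int,
  e (nth x0 c `|(z %% size c)%Z|) (nth x0 c `|((z + 1) %% size c)%Z|).
Proof.
case: c => // a c cyc _ z; set p := size (a :: c).
have p0 : p%:Z != 0 by [].
have r0 := modz_ge0 z p0.
have rp : (z %% p)%Z < p%:Z by rewrite ltz_pmod.
have -> : ((z + 1) %% p)%Z = (((z %% p)%Z + 1) %% p)%Z by rewrite modzDml.
move: (z %% p)%Z r0 rp => [r|//] _; rewrite ltz_nat => rp.
rewrite -[1]/(1%:Z) -PoszD modz_nat !absz_nat.
have step := (pathP x0 cyc) r; rewrite size_rcons in step.
move/step: (rp).
rewrite -rcons_cons !nth_rcons rp /=.
rewrite addn1; have [rc|rc|->] := ltngtP r (size c).
- by rewrite modn_small.
- by move: rp; rewrite /p /= ltnS leqNgt rc.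
- by rewrite modnn.
Qed.

(** Give [x] with [x *+ n = t *~ l] the height [l / n]: then [t] has height 1 and the generators
    have heights in [-1, 1]. If the box is moved by multiples of [t] to heights in [0, 1), its
    translates by multiples of [t] are blocks of which the generators link only equal or
    neighbouring ones, and [max_mean_cycle] applies to the graph of states. *)
Lemma extremal_of_levels (G : zmodType) (d1 d2 d3 t : G) (n : nat)
    (l1 l2 l3 : int) :
  (0 < n)%N -> (forall z : int, t *~ z = 0 -> z = 0) ->
  d1 *+ n = t *~ l1 -> d2 *+ n = t *~ l2 -> d3 *+ n = t *~ l3 ->
  `|l1| <= n%:Z -> `|l2| <= n%:Z -> `|l3| <= n%:Z ->
  extremal (set3 d1 d2 d3) (span3 d1 d2 d3).
Proof.
move=> n0 t_free n1 n2 n3 b1 b2 b3.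
have t_inj : injective (intmul t).
  by move=> y z E; apply/subr0_eq/t_free; rewrite mulrzBr E subrr.
pose D := set3 d1 d2 d3; pose bx := box d1 d2 d3 n.
have D_level d : D d -> exists2 l, d *+ n = t *~ l & `|l| <= n%:Z.
  by rewrite /D /set3 /= !inE => /or3P[] /eqP->; [exists l1|exists l2|exists l3].
have box_level x : x \in bx -> exists l, x *+ n = t *~ l.
  move=> /allpairsP[[x3 i3] /= [/allpairsP[[x2 i2] /= [/allpairsP[[x1 i1] /=
    [+ _ ->]] _ ->]] _ ->]].
  rewrite inE => /eqP ->; rewrite add0r.
  exists (l1 * i1%:Z + l2 * i2%:Z + l3 * i3%:Z).
  by rewrite !mulrzDr !mulrzA -n1 -n2 -n3 !mulrnDl -!pmulrn !(mulrnAC _ n).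
(* Euclidean division by [n] yields the multiple of [t] that normalizes the height. *)
have /choice[kap kapP] : forall x, exists k : int, x \in bx ->
    exists2 r : int, (x + t *~ k) *+ n = t *~ r & 0 <= r < n%:Z.
  move=> x.
  have [/box_level[l xl]|] := boolP (x \in bx); last by exists 0.
  exists (- (l %/ n)%Z) => _; exists (l %% n)%Z.
    rewrite mulrnDl xl [_ *+ n]pmulrn -mulrzA -mulrzDr.
    by congr intmul; rewrite {1}(divz_eq l n) mulNr addrC addKr.
  by rewrite modz_ge0 ?ltz_pmod //; lia.
pose gl := [seq x + t *~ kap x | x <- bx].
have gl_level i : (i < size gl)%N ->
    exists2 r : int, gl`_i *+ n = t *~ r & 0 <= r < n%:Z.
  move=> /(mem_nth 0) /mapP[x xb ->]; exact: kapP.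
have levelD x r z : x *+ n = t *~ r -> (x + t *~ z) *+ n = t *~ (r + n%:Z * z).
  by move=> E; rewrite mulrnDl E mulrzDr mulrzA pmulrn -!mulrzA mulrC.
have block_unique i j z z' : gl`_i + t *~ z = gl`_j + t *~ z' ->
    (i < size gl)%N -> (j < size gl)%N -> z = z'.
  move=> E /gl_level[r ri rn] /gl_level[r' rj rn'].
  have := congr1 (fun x => x *+ n) E.
  by rewrite (levelD _ r) // (levelD _ r') // => /t_inj; nia.
have D_local i j z z' : (i < size gl)%N -> (j < size gl)%N ->
    D ((gl`_i + t *~ z) - (gl`_j + t *~ z')) ->
    [\/ z = z', z = z' + 1 | z' = z + 1].
  move=> /gl_level[r ri rn] /gl_level[r' rj rn'] /D_level[l].
  rewrite mulrnBl (levelD _ r) // (levelD _ r') // -mulrzBr => /t_inj E ln.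
  have [] : (z = z' \/ z = z' + 1) \/ z' = z + 1 by nia.
    by case; [constructor 1|constructor 2].
  by constructor 3.
have e0 : succ_state D t (state gl set0) (state gl set0).
  by apply/asboolP; exists set0 => // a b [].
have [c [C [c0 cyc cmax]]] := max_mean_cycle (@state_weight _ gl) e0.
pose sig z := nth (state gl set0) c `|(z %% size c)%Z|.
have sigS z : succ_state D t (sig z) (sig (z + 1)) by apply: cycle_walk => //; exact/eqP.
pose P := glued t sig.
have avP : avoiding D P := glued_avoiding sigS D_local.
have PE := gluedE sigS block_unique.
have sigp z : sig (z + (size c)%:Z) = sig z by rewrite /sig modzDr.
have Pper x : ind P (x + t *+ size c) = ind P x.
  apply: ind_eq; split=> -[i [z [E s]]].
    exists i, (z - (size c)%:Z); split; last by rewrite -sigp subrK.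
    by rewrite mulrzBr addrA -E -pmulrn addrK.
  exists i, (z + (size c)%:Z); split; last by rewrite sigp.
  by rewrite mulrzDr addrA -E pmulrn.
have psP := period_sum_invariant Pper.
have psPz := invariant_intmul psP.
have sz_bx : size gl = (n ^ 3)%N by rewrite size_map size_box.
(* One period consists of [size c] blocks of [n ^ 3] elements. The error is scaled because
   [max_mean_cycle] counts blocks rather than elements. *)
exists (dilate bx t (size c)), (\sum_(y <- c) state_weight y)%N, (n ^ 3 * C)%N.
have c_gt0 : (0 < size c)%N by rewrite lt0n size_eq0.
split.
- by rewrite size_dilate size_box muln_gt0 expn_gt0 n0.
(* Adding [n] times a generator adds a multiple of [t], which leaves a sum over a period unchanged;
   for the same reason [gl] may replace the box. *)
- exists P => // h Hh; rewrite sum_dilate sum_box_invariant //; first last.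
  + by move=> x; rewrite n3.
  + by move=> x; rewrite n2.
  + by move=> x; rewrite n1.
  have -> : (\sum_(g <- box d1 d2 d3 n) period_sum t (size c) (ind P) g =
             \sum_(g <- gl) period_sum t (size c) (ind P) g)%N.
    by rewrite /gl big_map; apply: eq_bigr => g _; rewrite psPz.
  rewrite (big_nth (state gl set0)) /period_sum [leqRHS]exchange_big /=.
  rewrite big_nat_cond [leqRHS]big_nat_cond; apply: leq_sum => k.
  rewrite andbT => /andP[_ kc].
  rewrite [leqRHS](big_nth 0) big_mkord /state_weight; apply: leq_sum => i _.
  have sigk : sig k%:Z = nth (state gl set0) c k by rewrite /sig modz_nat modn_small.
  by rewrite -sigk -(asboolb (sig k%:Z i)); apply: ind_mono; rewrite pmulrn => /PE.
- move=> L; exists (dilate gl t L.+1); split.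
    by rewrite size_dilate sz_bx (leq_trans (leqnSn L)) // leq_pmull // expn_gt0 n0.
  move=> A avA.
  pose F l := state gl [set g | A (t *+ l + g)].
  have -> : (\sum_(g <- dilate gl t L.+1) ind A g =
             \sum_(y <- F 0%N :: map F (iota 1 L)) state_weight y)%N.
    transitivity (\sum_(g <- dilate gl t L.+1) ind A (0 + g)%R)%N.
      by apply: eq_bigr => g _; rewrite add0r.
    rewrite sum_dilate /period_sum exchange_big /= -[RHS]/(\sum_(y <- map F (index_iota 0 L.+1)) _)%N.
    rewrite big_map; apply: eq_bigr => l _; rewrite state_weightE.
    by apply: eq_bigr => g _; apply: ind_eq; rewrite /= add0r addrC.
  have := cmax _ _ (@path_states _ gl D t A 0 L avA).
  rewrite -/(F 0%N) -/F /= size_map size_iota.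
  move: (\sum_(y <- _ :: _) _)%N (\sum_(y <- c) _)%N => S W.
  rewrite !size_dilate mul1n; move: (size c) => p le; rewrite sz_bx.
  have -> : (n * n * n = n ^ 3)%N by rewrite !expnS muln1 mulnA.
  rewrite !(mulnCA _ (n ^ 3)%N) -mulnDr leq_mul2l.
  by apply/orP; right; exact: le.
Qed.

(** * Three generators *)

Section Relations.
Variable G : zmodType.
Implicit Types d : G.

Lemma lin3_swap d1 d2 d3 i j k : lin3 d1 d3 d2 i k j = lin3 d1 d2 d3 i j k.
Proof. by rewrite /lin3 addrAC. Qed.

Lemma lin3_rot d1 d2 d3 i j k : lin3 d2 d3 d1 j k i = lin3 d1 d2 d3 i j k.
Proof. by rewrite /lin3 addrC addrA. Qed.

Lemma extremal_swap d1 d2 d3 :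
  extremal (set3 d1 d3 d2) (span3 d1 d3 d2) ->
  extremal (set3 d1 d2 d3) (span3 d1 d2 d3).
Proof.
have -> : set3 d1 d3 d2 = set3 d1 d2 d3.
  by apply/seteqP; split=> x /=; rewrite /set3 /= !inE (orbC (x == d3)).
suff -> : span3 d1 d3 d2 = span3 d1 d2 d3 by [].
by apply/seteqP; split=> x [i [j [k ->]]]; exists i, k, j; rewrite lin3_swap.
Qed.

Lemma extremal_rot d1 d2 d3 :
  extremal (set3 d2 d3 d1) (span3 d2 d3 d1) ->
  extremal (set3 d1 d2 d3) (span3 d1 d2 d3).
Proof.
have -> : set3 d2 d3 d1 = set3 d1 d2 d3.
  by apply/seteqP; split=> x /=; rewrite /set3 /= !inE => /or3P[] ->; rewrite ?orbT.
suff -> : span3 d2 d3 d1 = span3 d1 d2 d3 by [].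
apply/seteqP; split=> x [i [j [k ->]]]; first by exists k, i, j; rewrite lin3_rot.
by exists j, k, i; rewrite (lin3_rot d1).
Qed.

(** If [d3] is torsion, so are all three; otherwise a multiple of [d3] serves as [t]. *)
Lemma extremal_of_commensurable d1 d2 d3 (m a b : int) : m != 0 ->
  d1 *~ m = d3 *~ a -> d2 *~ m = d3 *~ b ->
  extremal (set3 d1 d2 d3) (span3 d1 d2 d3).
Proof.
move=> m0 e1 e2.
pose n0 := `|m|%N; have n0_gt0 : (0 < n0)%N by rewrite absz_gt0.
have toN d c : d *~ m = d3 *~ c -> d *+ n0 = d3 *~ (sgz m * c).
  have -> : d *+ n0 = d *~ (m * sgz m) by rewrite mulrC -abszEsg pmulrn.
  by move=> E; rewrite mulrzA E -mulrzA mulrC.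
have {e1 m0}e1 := toN _ _ e1; have {e2}e2 := toN _ _ e2.
move: (sgz m * a) (sgz m * b) e1 e2 => {}a {}b e1 e2.
have [[z zN0 z0]|free] := pselect (exists2 z : int, z != 0 & d3 *~ z = 0).
  pose r := `|z|%N; have r0 : d3 *+ r = 0.
    have -> : d3 *+ r = d3 *~ (z * sgz z) by rewrite mulrC -abszEsg pmulrn.
    by rewrite mulrzA z0 mul0rz.
  apply: (@extremal_of_torsion _ _ _ _ (n0 * r)%N).
  - by rewrite muln_gt0 n0_gt0 absz_gt0.
  - by rewrite mulrnA e1 pmulrn -mulrzA mulrC mulrzA -pmulrn r0 mul0rz.
  - by rewrite mulrnA e2 pmulrn -mulrzA mulrC mulrzA -pmulrn r0 mul0rz.
  - by rewrite mulnC mulrnA r0 mul0rn.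
(* [M] is large enough for the levels [a], [b] and [n0] to be at most [n0 * M] in absolute value. *)
pose M := (`|a| + `|b|).+1.
apply: (@extremal_of_levels _ _ _ _ (d3 *+ M) (n0 * M)%N a b n0%:Z).
- by rewrite muln_gt0 n0_gt0.
- move=> z; rewrite pmulrn -mulrzA => z0.
  apply/eqP; apply/negP => /negP zN0; apply: free; exists (M%:Z * z) => //.
  by rewrite mulf_neq0.
- by rewrite mulrnA e1 !pmulrn -!mulrzA mulrC.
- by rewrite mulrnA e2 !pmulrn -!mulrzA mulrC.
- by rewrite mulnC mulrnA.
- rewrite /M; nia.
- rewrite /M; nia.
- rewrite /M; nia.
Qed.

(** By Cramer's rule the minor times [d1] and the minor times [d2] are multiples of [d3]. *)
Lemma extremal_of_two_relations d1 d2 d3 (u1 u2 u3 v1 v2 v3 : int) :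
  lin3 d1 d2 d3 u1 u2 u3 = 0 -> lin3 d1 d2 d3 v1 v2 v3 = 0 ->
  u1 * v2 - u2 * v1 != 0 ->
  extremal (set3 d1 d2 d3) (span3 d1 d2 d3).
Proof.
move=> u0 v0 m0.
have comb x y : lin3 d1 d2 d3 (u1 * x - v1 * y) (u2 * x - v2 * y)
    (u3 * x - v3 * y) = 0.
  by rewrite -lin3B -!lin3M u0 v0 !mul0rz subrr.
apply: (@extremal_of_commensurable _ _ _ (u1 * v2 - u2 * v1)
  (v3 * u2 - u3 * v2) (u3 * v1 - v3 * u1)) => //.
- rewrite (lin3_1 d1 d2 d3) (lin3_3 d1 d2 d3); apply: subr0_eq.
  by rewrite lin3B -(comb v2 u2); congr lin3; ring.
- rewrite (lin3_2 d1 d2 d3) (lin3_3 d1 d2 d3); apply: subr0_eq.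
  by rewrite lin3B -[RHS]oppr0 -(comb v1 u1) lin3N; congr lin3; ring.
Qed.

(** All minors vanish: the lattice of relations has rank at most one. *)
Definition relations_parallel d1 d2 d3 := forall u1 u2 u3 v1 v2 v3,
  lin3 d1 d2 d3 u1 u2 u3 = 0 -> lin3 d1 d2 d3 v1 v2 v3 = 0 ->
  [/\ u1 * v2 = u2 * v1, u1 * v3 = u3 * v1 & u2 * v3 = u3 * v2].

(** A relation [v] with least nonzero [|v1|] generates all relations. Its signs define the map to a
    cycle of length [|v1| + |v2| + |v3|], and following [v] step by step is a closed walk of that
    length. *)
Lemma extremal_of_parallel_relations d1 d2 d3 (u1 u2 u3 : int) :
  d1 != 0 -> relations_parallel d1 d2 d3 ->
  lin3 d1 d2 d3 u1 u2 u3 = 0 -> u1 != 0 ->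
  extremal (set3 d1 d2 d3) (span3 d1 d2 d3).
Proof.
move=> d1N0 par u0 u1N0.
pose P k := `[< exists v1 v2 v3 : int,
  [/\ lin3 d1 d2 d3 v1 v2 v3 = 0, v1 != 0 & `|v1|%N = k] >].
have ex : exists k, P k by exists `|u1|%N; apply/asboolP; exists u1, u2, u3.
case: (ex_minnP ex) => k /asboolP[v1 [v2 [v3 [v0 v1N0 vk]]]] kmin.
have gen w1 w2 w3 : lin3 d1 d2 d3 w1 w2 w3 = 0 ->
    exists q, [/\ w1 = q * v1, w2 = q * v2 & w3 = q * v3].
  (* The remainder has first coordinate below [|v1|], hence zero; being parallel to [v], it
     vanishes. *)
  move=> w0; exists (w1 %/ v1)%Z; set q := (w1 %/ v1)%Z.
  have r0 : lin3 d1 d2 d3 (w1 - v1 * q) (w2 - v2 * q) (w3 - v3 * q) = 0.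
    by rewrite -lin3B -lin3M w0 v0 mul0rz subrr.
  have rE : w1 - v1 * q = (w1 %% v1)%Z by rewrite /modz mulrC.
  have r1 : w1 - v1 * q = 0.
    apply/eqP; apply/negP => /negP rN0.
    have /kmin : P (absz (w1 - v1 * q)%R).
      by apply/asboolP; exists (w1 - v1 * q), (w2 - v2 * q), (w3 - v3 * q).
    rewrite leqNgt -vk -ltz_nat rE !abszE => /negP; apply.
    by rewrite ger0_norm ?modz_ge0 // ltz_mod.
  have [] := par _ _ _ _ _ _ r0 v0; rewrite r1 !mul0r.
  move=> /esym/eqP; rewrite mulf_eq0 (negbTE v1N0) orbF => /eqP r2.
  move=> /esym/eqP; rewrite mulf_eq0 (negbTE v1N0) orbF => /eqP r3 _.
  by split; apply: subr0_eq; rewrite mulrC.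
pose s (z : int) : int := if 0 <= z then 1 else -1.
have s1 z : s z = 1 \/ s z = -1 by rewrite /s; case: ifP; [left|right].
have sE z : s z * z = `|z|%N%:Z by rewrite /s; case: ifP; lia.
have sE' z : s z * `|z|%N%:Z = z by rewrite /s; case: ifP; lia.
pose blk d (z : int) := nseq `|z|%N (d *~ s z).
have sum_blk (d : G) z : \sum_(x <- blk d z) x = d *~ z.
  by rewrite big_nseq -Monoid.iteropE /= -[iterop _ _ _ _]/(_ *+ _)
    pmulrn -mulrzA sE'.
pose steps := blk d1 v1 ++ blk d2 v2 ++ blk d3 v3.
have sz : size steps = (`|v1| + (`|v2| + `|v3|))%N.
  by rewrite !size_cat !size_nseq.
apply: (@extremal_of_cycle _ _ _ _ (s v1) (s v2) (s v3) steps) => //.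
- rewrite sz; have v1_gt0 : (0 < `|v1|)%N by rewrite absz_gt0.
  (* A walk of length at most 1 would make [v] plus or minus the first unit vector, forcing
     [d1 = 0]. *)
  rewrite ltnNge; apply/negP => le1.
  have [v20 v30] : v2 = 0 /\ v3 = 0 by lia.
  move: v0 d1N0; rewrite v20 v30 -lin3_1.
  have [->|->] : v1 = 1 \/ v1 = -1 by lia.
    by rewrite mulr1z => ->; rewrite eqxx.
  by rewrite mulrNz mulr1z => /eqP; rewrite oppr_eq0 => ->.
- move=> i j l /gen[q [-> -> ->]]; rewrite sz.
  apply/dvdzP; exists q; rewrite !PoszD -!sE; ring.
- have sb d z x : x \in blk d z -> x = d \/ - x = d.
    rewrite mem_nseq => /andP[_ /eqP ->].
    by case: (s1 z) => ->; [left|right]; rewrite ?mulrNz ?mulr1z ?opprK.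
  move=> x; rewrite !mem_cat /set3 /= => /or3P[] /sb[->|->];
    by rewrite !inE eqxx ?orbT; (left + right).
- by rewrite !big_cat /= !sum_blk -v0 /lin3 addrA.
Qed.

(** Without relations the parity of [i + j + k] is well defined, and going forth and back along [d1]
    is a closed walk of length 2. *)
Lemma extremal_of_free d1 d2 d3 :
  (forall i j k, lin3 d1 d2 d3 i j k = 0 -> [/\ i = 0, j = 0 & k = 0]) ->
  extremal (set3 d1 d2 d3) (span3 d1 d2 d3).
Proof.
move=> free.
apply: (@extremal_of_cycle _ _ _ _ 1 1 1 [:: d1; - d1]); try by left.
- by [].
- by move=> i j k /free[-> -> ->].
- move=> x; rewrite /set3 /= !inE => /orP[] /eqP ->; [left|right];
    by rewrite ?opprK eqxx.
- by rewrite big_cons big_seq1 subrr.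
Qed.

Lemma extremal_three d1 d2 d3 : d1 != 0 -> d2 != 0 -> d3 != 0 ->
  extremal (set3 d1 d2 d3) (span3 d1 d2 d3).
Proof.
move=> n1 n2 n3.
have [par|npar] := pselect (relations_parallel d1 d2 d3); last first.
  (* Some minor is nonzero; permuting the generators puts it in the first two coordinates. *)
  move/existsNP: npar => [u1 /existsNP[u2 /existsNP[u3 /existsNP[v1
    /existsNP[v2 /existsNP[v3 /not_implyP[u0 /not_implyP[v0 npar]]]]]]]].
  have [E12|N12] := eqVneq (u1 * v2) (u2 * v1); last first.
    by apply: (extremal_of_two_relations u0 v0); rewrite subr_eq0.
  have [E13|N13] := eqVneq (u1 * v3) (u3 * v1); last first.
    apply: extremal_swap; rewrite -lin3_swap in u0; rewrite -lin3_swap in v0.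
    by apply: (extremal_of_two_relations u0 v0); rewrite subr_eq0.
  have [E23|N23] := eqVneq (u2 * v3) (u3 * v2); first by case: npar.
  apply: extremal_rot; rewrite -lin3_rot in u0; rewrite -lin3_rot in v0.
  by apply: (extremal_of_two_relations u0 v0); rewrite subr_eq0.
have [free|nfree] := pselect (forall i j k,
    lin3 d1 d2 d3 i j k = 0 -> [/\ i = 0, j = 0 & k = 0]).
  exact: extremal_of_free.
move/existsNP: nfree => [u1 /existsNP[u2 /existsNP[u3 /not_implyP[u0 nfree]]]].
have [E1|N1] := eqVneq u1 0; last exact: (extremal_of_parallel_relations n1 par u0).
have [E2|N2] := eqVneq u2 0; last first.
  apply: extremal_rot; rewrite -lin3_rot in u0.
  apply: (extremal_of_parallel_relations n2 _ u0 N2) => a b c a' b' c'.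
  by rewrite !(lin3_rot d1 d2) => h h'; have [] := par _ _ _ _ _ _ h h'.
have [E3|N3] := eqVneq u3 0; first by case: nfree.
do 2 apply: extremal_rot; rewrite -lin3_rot -lin3_rot in u0.
apply: (extremal_of_parallel_relations n3 _ u0 N3) => a b c a' b' c'.
by rewrite !(lin3_rot d2 d3) !(lin3_rot d1 d2) => h h'; have [] := par _ _ _ _ _ _ h h'.
Qed.
End Relations.

(** * Haar measure and translates *)

Definition translate (G : zmodType) (x : G) (A : set G) : set G :=
  [set y | A (y - x)].

(** As [x = y] entails [b = b'], this says that translates of [C] by distinct elements of [B] are
    disjoint. *)
Definition separated_by (G : zmodType) (B : seq G) (C : set G) : Prop :=
  forall x y b b', C x -> C y -> b \in B -> b' \in B -> x + b = y + b' -> x = y.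

Section Topology.
Variable G : topologicalZmodType.

Lemma open_translate (x : G) (A : set G) : open A -> open (translate x A).
Proof.
move=> oA; apply: open_comp oA => y _.
apply: (@continuous2_cvg _ _ _ _ _ _ _ _ (fun a b : G => a - b)).
- exact: (@sub_continuous G (y, x)).
- exact: cvg_id.
- exact: cvg_cst.
Qed.

(* compact_cover is stated for pointed spaces. *)
Definition pointed_carrier : Type := G.
HB.instance Definition _ := Topological.on pointed_carrier.
HB.instance Definition _ := isPointed.Build pointed_carrier 0.

Lemma finite_open_cover_translates (V : set G) :
  compact [set: G] -> open V -> V 0 ->
  exists xs : seq G, forall y, exists2 x, x \in xs & translate x V y.
Proof.
move=> cG oV V0.
have := cG; rewrite (compact_cover pointed_carrier : @compact G = _).
move=> /(_ G setT (fun x => translate x V)) [].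
- by move=> x _; exact: open_translate.
- by move=> y _; exists y => //=; rewrite /translate /= subrr.
move=> xs _ cov; exists (finmap.enum_fset xs) => y.
by have [x] := cov y I; exists x.
Qed.

(** The nonzero differences of [B] form a finite set, closed in a Hausdorff group and missing 0. A
    neighbourhood [V] of 0 with [V - V] disjoint from it is separated, and so are its translates. *)
Lemma separated_open_cover (B : seq G) :
  hausdorff_space G -> compact [set: G] ->
  exists Cs : seq (set G), (forall y, exists2 C, C \in Cs & C y) /\
    forall C, C \in Cs -> open C /\ separated_by B C.
Proof.
move=> hG cG.
pose fs := [seq f <- [seq b' - b | b <- B, b' <- B] | f != 0].
have clf : closed [set f | f \in fs].
  apply: (accessible_finite_set_closed.1 (hausdorff_accessible hG)).
  exact: finite_seq.
have nO : nbhs (0 - 0 : G) (~` [set f | f \in fs]).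
  apply: open_nbhs_nbhs; split; first exact: closed_openC.
  by rewrite subrr /= mem_filter eqxx.
have [[U1 U2] /= [n1 n2] sub] := @sub_continuous G (0, 0) _ nO.
pose V := (U1 `&` U2)^°.
have V0 : V 0 by exact: filterI.
have [xs cov] := finite_open_cover_translates cG (@open_interior _ _) V0.
exists [seq translate x V | x <- xs]; split.
  by move=> y; have [x xxs Vx] := cov y; exists (translate x V) => //; exact: map_f.
move=> C /mapP[z _ ->]; split; first exact/open_translate/open_interior.
move=> x y b b' /interior_subset[/= x1 _] /interior_subset[/= _ y2] bB b'B E.
have := sub (x - z, y - z) (conj x1 y2).
rewrite /= opprB addrA subrK /= mem_filter => /negP.
rewrite negb_and negbK => /orP[/eqP/subr0_eq //|/negP[]].
suff -> : x - y = b' - b by exact: allpairs_f.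
by apply/eqP; rewrite subr_eq addrAC -subr_eq opprK E addrC.
Qed.

End Topology.

Section Haar.
Variables (G : topologicalZmodType) (R : realType).
Variable mu : probability (borel G) R.
Hypothesis haar : is_haar_prob mu.

Lemma open_borel (A : set G) : open A -> measurable (A : set (borel G)).
Proof. by move=> oA; exact: sub_sigma_algebra. Qed.

Lemma measurable_translate (x : G) (A : set G) :
  measurable (A : set (borel G)) -> measurable (translate x A : set (borel G)).
Proof.
move=> mA.
have mf : measurable_fun setT ((fun y => y - x) : borel G -> borel G).
  apply: (@measurability _ _ (borel G) (borel G) setT _ (@open G)) => // _ [U oU <-] /=.
  by rewrite setTI; apply: open_borel; exact: open_translate.
by have := mf measurableT _ mA; rewrite setTI.
Qed.

Definition vol (A : set G) : R := fine (mu A).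

Lemma volE (A : set G) : measurable (A : set (borel G)) -> mu A = (vol A)%:E.
Proof. by move=> mA; rewrite fineK // fin_num_measure. Qed.

Lemma vol_translate x (A : set G) : measurable (A : set (borel G)) ->
  vol (translate x A) = vol A.
Proof.
move=> mA; rewrite /vol -(haar.1 x A mA); congr (fine (mu _)).
apply/seteqP; split=> y /=.
  by move=> Ay; exists (y - x) => //; rewrite addrC subrK.
by case=> z Az <-; rewrite /translate /= addrC addKr.
Qed.

Lemma vol_ge0 (A : set G) : 0 <= vol A.
Proof. by rewrite fine_ge0. Qed.

Lemma le_vol (A B : set G) : measurable (A : set (borel G)) ->
  measurable (B : set (borel G)) -> A `<=` B -> vol A <= vol B.
Proof.
move=> mA mB AB; rewrite -lee_fin -!volE //.
by apply: le_measure; rewrite ?inE.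
Qed.

Lemma vol_setT : vol setT = 1.
Proof. by rewrite /vol probability_setT. Qed.

Lemma vol_set0 : vol set0 = 0.
Proof. by rewrite /vol measure0. Qed.

Lemma volU (A B : set G) : measurable (A : set (borel G)) ->
  measurable (B : set (borel G)) -> (forall x, A x -> ~ B x) ->
  vol (A `|` B) = vol A + vol B.
Proof.
move=> mA mB AB; apply: EFin_inj; rewrite EFinD -!volE //; last exact: measurableU.
rewrite measureU //; apply/seteqP; split=> x // -[Ax Bx]; exact: (AB x).
Qed.

Definition seq_union (s : seq G) (F : G -> set G) : set G :=
  [set x | exists2 b, b \in s & F b x].

Lemma seq_union_cons b s F : seq_union (b :: s) F = F b `|` seq_union s F.
Proof.
apply/seteqP; split=> x.
  by move=> [b']; rewrite inE => /predU1P[-> ?|bs ?]; [left|right; exists b'].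
move=> [Fx|[b' bs Fx]]; first by exists b; rewrite ?mem_head.
by exists b' => //; rewrite inE bs orbT.
Qed.

Lemma seq_union_nil F : seq_union [::] F = set0.
Proof. by apply/seteqP; split=> x // -[]. Qed.

Lemma measurable_seq_union s F :
  (forall b, measurable (F b : set (borel G))) ->
  measurable (seq_union s F : set (borel G)).
Proof.
move=> mF; elim: s => [|b s IH]; first by rewrite seq_union_nil; exact: measurable0.
by rewrite seq_union_cons; exact: measurableU.
Qed.

Lemma vol_seq_union s F : uniq s ->
  (forall b, measurable (F b : set (borel G))) ->
  (forall b b' x, b \in s -> b' \in s -> F b x -> F b' x -> b = b') ->
  vol (seq_union s F) = \sum_(b <- s) vol (F b).
Proof.
move=> + mF; elim: s => [|b s IH] /=.
  by rewrite seq_union_nil vol_set0 big_nil.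
move=> /andP[bs us] dis; rewrite seq_union_cons big_cons volU //.
- rewrite IH // => a a' x as_ a's; apply: dis; by rewrite inE ?as_ ?a's orbT.
- exact: measurable_seq_union.
- move=> x Fb [b' b's Fb']; move: bs.
  by rewrite (dis b b' x) ?b's // ?mem_head // inE b's orbT.
Qed.

Lemma packing_vol_le (gs : seq G) (c : nat) (A : set G) :
  measurable (A : set (borel G)) ->
  (forall x, (\sum_(g <- gs) ind A (x + g)%R <= c)%N) ->
  vol A * (size gs)%:R <= c%:R.
Proof.
move=> mA le.
have mT g := measurable_translate (- g) mA.
pose f g (x : borel G) : \bar R := (\1_(translate (- g) A) x)%:E.
have mf g : measurable_fun setT (f g).
  by apply/measurable_EFinP; exact: measurable_indic.
have f0 g x : setT x -> (0 <= f g x)%E by move=> _; rewrite lee_fin.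
have E : (\int[mu]_x (\sum_(g <- gs) f g x) = (vol A * (size gs)%:R)%:E)%E.
  rewrite ge0_integral_sum //.
  have integ g : (\int[mu]_x f g x = (vol A)%:E)%E.
    rewrite integral_indic // setIT -(vol_translate (- g) mA).
    exact: volE.
  under eq_bigr do rewrite integ.
  by rewrite sumEFin big_const_seq count_predT iter_addr_0 mulr_natr.
rewrite -lee_fin -E.
have -> : (c%:R)%:E = (\int[mu]_x (cst (c%:R)%:E x))%E.
  rewrite integral_cst //.
  rewrite -[LHS]mule1; congr (_ * _)%E.
  exact/esym/(probability_setT mu).
apply: ge0_le_integral => //.
- by move=> x _; apply: sume_ge0 => g _; exact: f0.
- by apply: emeasurable_sum => g; exact: mf.
- move=> x _; rewrite sumEFin lee_fin.
  have : (\sum_(g <- gs) ind A (x + g)%R)%:R <= c%:R :> R by rewrite ler_nat.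
  apply: le_trans; rewrite natr_sum; apply: ler_sum => g _.
  rewrite indicE ler_nat /ind /translate /= opprK.
  by apply/eq_leq; congr nat_of_bool; rewrite asboolE.
Qed.
End Haar.

(** * Region growing *)

Lemma exists_ge_average (R : realDomainType) (I : eqType) (s : seq I)
    (f : I -> R) (K : R) :
  s != [::] -> K *+ size s <= \sum_(i <- s) f i ->
  exists2 i, i \in s & K <= f i.
Proof.
move=> s0 le; have [//|nex] := pselect (exists2 i, i \in s & K <= f i).
suff : \sum_(i <- s) f i < K *+ size s by rewrite ltNge le.
have lt i : i \in s -> f i < K.
  by move=> si; rewrite ltNge; apply/negP => Ki; apply: nex; exists i.
have -> : K *+ size s = \sum_(i <- s) K by rewrite big_const_seq count_predT iter_addr_0.
rewrite big_seq [ltRHS]big_seq; apply: ltr_sum => //.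
by apply/hasP; case: (s) s0 => // a l _; exists a; rewrite mem_head.
Qed.

(** Otherwise [V] grows by a factor above [1 + e] in each of [n] steps and passes [K *+ N]. *)
Lemma small_growth_step (R : realFieldType) (V : nat -> R) (e K : R) (n N : nat) :
  (0 < N)%N -> 0 <= e -> 0 <= K -> (forall r, 0 <= V r) -> K <= V 0%N ->
  V n <= K *+ N -> N%:R < (1 + e) ^+ n ->
  exists2 r, (r < n)%N & V r.+1 <= (1 + e) * V r.
Proof.
move=> N_gt0 e0 K0 V0 KV Vn Nn.
have [//|nex] := pselect (exists2 r, (r < n)%N & V r.+1 <= (1 + e) * V r).
have lt r : (r < n)%N -> (1 + e) * V r < V r.+1.
  by move=> rn; rewrite ltNge; apply/negP => le; apply: nex; exists r.
have grow r : (r <= n)%N -> (1 + e) ^+ r * V 0%N <= V r.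
  elim: r => [|r IH] rn; first by rewrite expr0 mul1r.
  rewrite exprS -mulrA (le_trans _ (ltW (lt _ rn))) // ler_wpM2l ?addr_ge0 //.
  by apply: IH; exact: ltnW.
have le := le_trans (grow _ (leqnn n)) Vn.
have K_eq0 : K = 0.
  apply/eqP; rewrite eq_le K0 andbT leNgt; apply/negP => Kgt0.
  have : (1 + e) ^+ n * K <= N%:R * K.
    rewrite [leRHS]mulrC mulr_natr; apply: le_trans le.
    by rewrite ler_wpM2l // exprn_ge0 // addr_ge0.
  by rewrite ler_pM2r // leNgt Nn.
(* With [K = 0] the last step is contradictory, as its end value is at most 0; no step at all would
   contradict [0 < N]. *)
case: n Vn Nn lt {grow le nex} => [|n] Vn Nn lt.
  by move: Nn; rewrite expr0 -[1]/(1%:R) ltr_nat ltnNge N_gt0.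
have := lt_le_trans (lt n (ltnSn n)) Vn.
by rewrite K_eq0 mul0rn ltNge mulr_ge0 // addr_ge0.
Qed.

Section RegionGrowing.
Variables (G : topologicalZmodType) (R : realType).
Variable mu : probability (borel G) R.
Hypothesis haar : is_haar_prob mu.
Variables (D P : set G) (gs : seq G) (c : nat) (B : nat -> seq G).
Hypothesis gs0 : gs != [::].
Hypothesis avP : avoiding D P.
Hypothesis B_uniq : forall r, uniq (B r).
Hypothesis B0 : forall r, 0 \in B r.
Hypothesis B_mono : forall r r', (r <= r')%N -> {subset B r <= B r'}.
Hypothesis BD : forall r b d, b \in B r -> D d ->
  (b + d \in B r.+1) /\ (b - d \in B r.+1).
Hypothesis Pcover : forall r b, b \in B r ->
  (c <= \sum_(g <- gs) ind P (b + g)%R)%N.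
Variables (e : R) (n : nat).
Hypothesis e_gt0 : 0 < e.
Hypothesis growth : (size (B n))%:R < (1 + e) ^+ n.

(** One round of region growing. All points of [C] in [Y] get a ball of the same radius [r < n]
    whose layer up to [r.+1] is small; [A] fills the balls following a shift of [P], and [Y'] is
    what remains without balls and layers. *)
Lemma carve (C Y : set G) :
  measurable (C : set (borel G)) -> measurable (Y : set (borel G)) ->
  separated_by (B n) C ->
  exists A Y' : set G,
    [/\ measurable (A : set (borel G)), measurable (Y' : set (borel G)),
        A `<=` Y `\` Y' /\ Y' `<=` Y `\` C, avoiding D A &
        (forall a y, A a -> Y' y -> ~ D (a - y) /\ ~ D (y - a)) /\
        c%:R * (vol mu Y - vol mu Y') <= (1 + e) * (size gs)%:R * vol mu A].
Proof.
move=> mC mY sep.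
pose C' := C `&` Y.
have mC' : measurable (C' : set (borel G)) by exact: measurableI.
pose piece b : set G := translate b C' `&` Y.
have mp b : measurable (piece b : set (borel G)).
  by apply: measurableI => //; exact: measurable_translate.
have piece_inj b b' x : b \in B n -> b' \in B n -> piece b x -> piece b' x -> b = b'.
  move=> bB b'B [[Cx _] _] [[Cx' _] _].
  have /addrI/oppr_inj// : x - b = x - b'.
  by apply: (sep _ _ b b') => //; rewrite !subrK.
pose U r := seq_union (B r) piece.
pose V r := vol mu (U r).
have mU r : measurable (U r : set (borel G)) by exact: measurable_seq_union.
have VE r : (r <= n)%N -> V r = \sum_(b <- B r) vol mu (piece b).
  move=> rn; apply: vol_seq_union => // b b' x bB b'B.
  by apply: piece_inj; exact: (B_mono rn).
have C'0 : C' `<=` piece 0.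
  by move=> x [Cx Yx]; split=> //; split; rewrite subr0.
have [r rn Vr] : exists2 r, (r < n)%N & V r.+1 <= (1 + e) * V r.
  apply: (@small_growth_step _ V e (vol mu C') n (size (B n))) => //.
  - by rewrite lt0n size_eq0; apply/negP => /eqP E; have := B0 n; rewrite E.
  - exact: ltW.
  - exact: vol_ge0.
  - by move=> r; exact: vol_ge0.
  - by apply: le_vol => // x Cx; exists 0; [exact: B0|exact: C'0].
  - rewrite VE //; have -> : vol mu C' *+ size (B n) = \sum_(b <- B n) vol mu C'.
      by rewrite big_const_seq count_predT iter_addr_0.
    apply: ler_sum => b _; rewrite -(vol_translate haar b mC').
    by apply: le_vol => //; [exact: measurable_translate|move=> x []].
have rn' := ltnW rn.
pose sel g := [seq b <- B r | `[< P (b + g) >]].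
pose A g := seq_union (sel g) piece.
have volA g : vol mu (A g) = \sum_(b <- B r) (ind P (b + g))%:R * vol mu (piece b).
  rewrite vol_seq_union //; last 2 first.
  - exact: filter_uniq.
  - move=> b b' x; rewrite !mem_filter => /andP[_ bB] /andP[_ b'B].
    by apply: piece_inj; exact: (B_mono rn').
  rewrite big_filter big_mkcond; apply: eq_bigr => b _.
  by rewrite /ind; case: asboolP; rewrite ?mul1r ?mul0r.
(* Over all [g] in [gs], each piece is used at least [c] times, so some shift reaches the
   average. *)
have [g ggs gA] : exists2 g, g \in gs &
    c%:R * V r / (size gs)%:R <= vol mu (A g).
  apply: exists_ge_average => //.
  rewrite -[leLHS]mulr_natr divfK; last by rewrite pnatr_eq0 size_eq0.
  under eq_bigr do rewrite volA.
  rewrite exchange_big VE // mulr_sumr big_seq [leRHS]big_seq.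
  apply: ler_sum => b bB; rewrite -mulr_suml ler_wpM2r ?vol_ge0 //.
  by rewrite -natr_sum ler_nat; exact: Pcover bB.
have selB b : b \in sel g -> P (b + g) /\ b \in B r.
  by rewrite mem_filter => /andP[/asboolP].
exists (A g), (Y `\` U r.+1); split.
- exact: measurable_seq_union.
- exact: measurableD.
- split=> x.
    move=> [b /selB[_ bB] [Cx Yx]]; split=> // -[_]; apply.
    by exists b; first exact: (B_mono (leqnSn r)).
  move=> [Yx nU]; split=> // Cx; apply: nU.
  by exists 0; [exact: B0|exact: C'0].
- move=> x y [b /selB[Pb bB] [[Cx _] _]] [b' /selB[Pb' b'B] [[Cy _] _]] Dxy.
  apply: (avP Pb Pb').
  (* Since [b' + (x - y)] lies in [B r.+1], hence in [B n], separation puts [x] and [y] over the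
     same point of [C]; then [x - y] is a difference of two elements of [P]. *)
  have E : x - b = y - b'.
    apply: (sep _ _ b (b' + (x - y))) => //.
    + exact: (B_mono rn').
    + by apply: (B_mono rn); exact: (BD b'B Dxy).1.
    + by rewrite subrK addrA subrK addrC subrK.
  suff -> : b + g - (b' + g) = x - y by [].
  rewrite opprD addrACA subrr addr0.
  have -> : x = y - b' + b by rewrite -E subrK.
  by rewrite [y - b']addrC -!addrA [y + _]addrCA subrr addr0 addrC.
- split.
    (* A point of [Y] linked to [A] lies in [U r.+1], which [Y'] has lost. *)
    move=> x y [b /selB[_ bB] [Cx _]] [Yy nU].
    split=> Dxy; apply: nU.
      exists (b - (x - y)); first exact: (BD bB Dxy).2.
      split=> //; suff E : y - (b - (x - y)) = x - b by rewrite /translate /= E.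
      by rewrite opprB addrA [y + _]addrC subrK.
    exists (b + (y - x)); first exact: (BD bB Dxy).1.
    split=> //; suff E : y - (b + (y - x)) = x - b by rewrite /translate /= E.
    by rewrite opprD opprB addrC addrA subrK addrC.
  have -> : vol mu Y = vol mu (U r.+1) + vol mu (Y `\` U r.+1).
    rewrite -volU //; last by move=> x Ux [].
      congr vol; apply/seteqP; split=> x.
        by move=> Yx; have [|] := pselect (U r.+1 x); [left|right].
      by case=> [[b _ []]|[]].
    exact: measurableD.
  rewrite addrK.
  move: gA; rewrite ler_pdivrMr; last by rewrite ltr0n lt0n size_eq0.
  move=> gA; apply: (@le_trans _ _ (c%:R * ((1 + e) * V r))).
    by rewrite ler_wpM2l.
  rewrite mulrCA -mulrA; apply: ler_wpM2l; first by rewrite addr_ge0 // ltW.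
  by rewrite [leRHS]mulrC.
Qed.

(** What remains after carving along [C] misses [C], so the other sets still cover it. The carved
    sets are not linked by [D], and the estimates add up. *)
Lemma carve_cover (Cs : seq (set G)) (Y : set G) :
  (forall C, C \in Cs -> measurable (C : set (borel G)) /\ separated_by (B n) C) ->
  measurable (Y : set (borel G)) ->
  (forall y, Y y -> exists2 C, C \in Cs & C y) ->
  exists A : set G, [/\ measurable (A : set (borel G)), A `<=` Y, avoiding D A &
    c%:R * vol mu Y <= (1 + e) * (size gs)%:R * vol mu A].
Proof.
elim: Cs Y => [|C Cs IH] Y sepC mY cov.
  exists set0; split=> //.
  suff -> : Y = set0 by rewrite vol_set0 !mulr0.
  by apply/seteqP; split=> y // /cov[].
have [mC sC] := sepC C (mem_head _ _).
have [A1 [Y' [mA1 mY' [A1Y Y'Y] av1 [nadj le1]]]] := carve mC mY sC.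
have [|y Y'y|A2 [mA2 A2Y' av2 le2]] := IH Y' _ mY'.
- by move=> C' C's; apply: sepC; rewrite inE C's orbT.
- have [Yy nCy] := Y'Y _ Y'y; have [C' + C'y] := cov _ Yy.
  by rewrite inE => /predU1P[E|C's]; [rewrite E in C'y|exists C'].
exists (A1 `|` A2); split.
- exact: measurableU.
- by move=> x [/A1Y[]|/A2Y'/Y'Y[]].
- move=> a b [Aa|Aa] [Ab|Ab].
  + exact: av1.
  + exact: (nadj _ _ Aa (A2Y' _ Ab)).1.
  + exact: (nadj _ _ Ab (A2Y' _ Aa)).2.
  + exact: av2.
- rewrite volU // => [|x A1x A2x]; first by rewrite mulrDr; lra.
  by have [_] := A1Y _ A1x; apply; exact: A2Y'.
Qed.
End RegionGrowing.

(** * The density *)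

Lemma bernoulli_le (R : realDomainType) (e : R) n : 0 <= e ->
  1 + e *+ n <= (1 + e) ^+ n.
Proof.
move=> e0; elim: n => [|n IH]; first by rewrite expr0 mulr0n addr0.
rewrite exprS; apply: (@le_trans _ _ ((1 + e) * (1 + e *+ n))).
  rewrite mulrS; have := mulr_ge0 e0 (mulrn_wge0 n e0).
  by move: (e *+ n) => t et; lra.
by rewrite ler_wpM2l // addr_ge0.
Qed.

(** For [n = 4 * k], Bernoulli's inequality with exponent [k] bounds the right side below by the
    fourth power of [e * k], which beats the cube of [9 * k] once [k] exceeds [x]. *)
Lemma cube_lt_exponential (R : archiRealFieldType) (e : R) : 0 < e ->
  exists n, ((2 * n + 1) ^ 3)%:R < (1 + e) ^+ n.
Proof.
move=> e0; pose x := 729%:R / e ^+ 4.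
have x0 : 0 <= x by rewrite divr_ge0 // exprn_ge0 // ltW.
pose k := (Num.bound x).+1; exists (4 * k)%N.
have xk : x < k%:R by rewrite (lt_trans (archi_boundP x0)) // ltr_nat.
have k0 : 0 < k%:R :> R by rewrite ltr0n.
have le1 : ((2 * (4 * k) + 1) ^ 3)%:R <= (9 * k%:R) ^+ 3 :> R.
  rewrite natrX lerXn2r ?nnegrE ?mulr_ge0 // -natrM ler_nat; lia.
apply: (le_lt_trans le1); rewrite mulnC exprM.
have le2 : (e * k%:R) ^+ 4 <= ((1 + e) ^+ k) ^+ 4.
  rewrite lerXn2r ?nnegrE ?exprn_ge0 ?addr_ge0 ?mulr_ge0 ?ltW //.
  by have := bernoulli_le k (ltW e0); rewrite mulr_natr; lra.
apply: lt_le_trans le2; rewrite !exprMn [k%:R ^+ 4]exprS mulrA ltr_pM2r ?exprn_gt0 //.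
move: xk; rewrite /x ltr_pdivrMr ?exprn_gt0 // [ltRHS]mulrC.
by apply: le_lt_trans; rewrite -natrX.
Qed.

(** * Balls of cubic growth *)

Section BoxBalls.
Variables (G : zmodType) (d1 d2 d3 : G).

Definition int_ball (r : nat) : seq int :=
  [seq k%:Z - r%:Z | k <- iota 0 (2 * r + 1)].

Lemma mem_int_ball r z : (z \in int_ball r) = (`|z| <= r%:Z).
Proof.
apply/mapP/idP => [[k]|zr]; first by rewrite mem_iota => kr ->; lia.
by exists (absz (z + r%:Z)); rewrite ?mem_iota; lia.
Qed.

(** Unlike in [box], repetitions are removed, because carving needs distinct translates. *)
Definition box_ball r : seq G :=
  undup [seq d1 *~ p.1 + d2 *~ p.2 + d3 *~ k |
    p <- [seq (i, j) | i <- int_ball r, j <- int_ball r], k <- int_ball r].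

Lemma box_ballP r x : reflect
  (exists i j k : int, [/\ `|i| <= r%:Z, `|j| <= r%:Z, `|k| <= r%:Z &
     x = lin3 d1 d2 d3 i j k])
  (x \in box_ball r).
Proof.
rewrite mem_undup; apply: (iffP allpairsP).
  move=> [[p k] /= [/allpairsP[[i j] /= [+ + ->]] + ->]].
  by rewrite !mem_int_ball => ir jr kr; exists i, j, k.
move=> [i [j [k [ir jr kr ->]]]]; exists ((i, j), k) => /=.
by split; rewrite ?mem_int_ball //; apply: allpairs_f; rewrite mem_int_ball.
Qed.

Lemma size_box_ball r : (size (box_ball r) <= (2 * r + 1) ^ 3)%N.
Proof.
rewrite (leq_trans (size_undup _)) // !size_allpairs size_map size_iota.
by rewrite !expnS muln1 mulnA.
Qed.

Lemma box_ball_add r x d : x \in box_ball r -> set3 d1 d2 d3 d ->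
  (x + d \in box_ball r.+1) /\ (x - d \in box_ball r.+1).
Proof.
move=> /box_ballP[i [j [k [ir jr kr ->]]]].
have step a b c : `|a| <= 1 -> `|b| <= 1 -> `|c| <= 1 ->
    (lin3 d1 d2 d3 i j k + lin3 d1 d2 d3 a b c \in box_ball r.+1) /\
    (lin3 d1 d2 d3 i j k - lin3 d1 d2 d3 a b c \in box_ball r.+1).
  move=> a1 b1 c1; rewrite lin3B lin3D; split; apply/box_ballP.
    by exists (i + a), (j + b), (k + c); split=> //; lia.
  by exists (i - a), (j - b), (k - c); split=> //; lia.
rewrite /set3 /= !inE => /or3P[] /eqP ->.
- by rewrite -[d1 in _ + d1]mulr1z -[d1 in _ - d1]mulr1z (lin3_1 d1 d2 d3); exact: step.
- by rewrite -[d2 in _ + d2]mulr1z -[d2 in _ - d2]mulr1z (lin3_2 d1 d2 d3); exact: step.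
- by rewrite -[d3 in _ + d3]mulr1z -[d3 in _ - d3]mulr1z (lin3_3 d1 d2 d3); exact: step.
Qed.
End BoxBalls.

Section Density.
Variables (G : topologicalZmodType) (R : realType).
Variable mu : probability (borel G) R.
Hypothesis haus : hausdorff_space G.
Hypothesis comp : compact [set: G].
Hypothesis haar : is_haar_prob mu.

(** An excess over the ratio would accumulate linearly in the length of the family and outgrow
    [C]. *)
Lemma vol_le_of_packing (D A : set G) (gs : seq G) (c C : nat) :
  (0 < size gs)%N ->
  (forall L, exists gs', (L <= size gs')%N /\ forall A, avoiding D A ->
      ((\sum_(g <- gs') ind A g) * size gs <= c * size gs' + C)%N) ->
  measurable (A : set (borel G)) -> avoiding D A ->
  vol mu A <= c%:R / (size gs)%:R.
Proof.
move=> gs0 pack mA avA; rewrite ler_pdivlMr ?ltr0n //.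
rewrite leNgt; apply/negP => lt.
pose del := vol mu A * (size gs)%:R - c%:R.
have del0 : 0 < del by rewrite subr_gt0.
pose L := Num.bound (C%:R / del).
have CL : C%:R < del * L%:R.
  rewrite mulrC -ltr_pdivrMr //; apply: archi_boundP.
  by rewrite divr_ge0 // ltW.
have [gs' [Lgs' pk]] := pack L.
pose q := ((c * size gs' + C) %/ size gs)%N.
have le : vol mu A * (size gs')%:R <= q%:R.
  apply: packing_vol_le => // x; rewrite /q leq_divRL //.
  have := pk _ (avoiding_shift (x := x) avA); apply: leq_trans.
  by rewrite leq_mul2r; apply/orP; right; apply: leq_sum => g _; exact: ind_mono.
have le' : vol mu A * (size gs')%:R * (size gs)%:R <= c%:R * (size gs')%:R + C%:R.
  apply: le_trans (_ : q%:R * (size gs)%:R <= _).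
    by rewrite ler_wpM2r.
  by rewrite -!natrM -natrD ler_nat leq_trunc_div.
have : del * (size gs')%:R <= C%:R by rewrite /del; lra.
apply/negP; rewrite -ltNge (lt_le_trans CL) // ler_wpM2l ?ler_nat //.
exact: ltW.
Qed.

Lemma exists_dense_avoiding (d1 d2 d3 : G) (P : set G) (gs : seq G) (c : nat) (e : R) :
  (0 < size gs)%N -> avoiding (set3 d1 d2 d3) P ->
  (forall h, span3 d1 d2 d3 h -> (c <= \sum_(g <- gs) ind P (h + g)%R)%N) ->
  0 < e ->
  exists A : set G, [/\ measurable (A : set (borel G)),
    avoiding (set3 d1 d2 d3) A & c%:R / (size gs)%:R <= vol mu A + e].
Proof.
move=> gs0 avP cov e0.
have [n nP] := cube_lt_exponential e0.
pose B := box_ball d1 d2 d3.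
have growth : (size (B n))%:R < (1 + e) ^+ n.
  by apply: le_lt_trans nP; rewrite ler_nat size_box_ball.
have [Cs [Ccov Csep]] := separated_open_cover (B n) haus comp.
have [] := @carve_cover _ _ _ haar (set3 d1 d2 d3) P gs c B _ avP _ _ _ _ _ e n e0 growth Cs setT.
- by rewrite -size_eq0 -lt0n.
- by move=> r; exact: undup_uniq.
- by move=> r; apply/box_ballP; exists 0, 0, 0; rewrite /lin3 !mulr0z !addr0.
- move=> r r' rr x /box_ballP[i [j [k [ir jr kr ->]]]]; apply/box_ballP.
  by exists i, j, k; split=> //; lia.
- by move=> r b d; exact: box_ball_add.
- by move=> r b /box_ballP[i [j [k [_ _ _ ->]]]]; apply: cov; exists i, j, k.
- by move=> C /Csep[oC sC]; split=> //; exact: open_borel.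
- exact: measurableT.
- by move=> y _; exact: Ccov.
move=> A [mA _ avA]; rewrite vol_setT mulr1 => le.
exists A; split=> //; rewrite ler_pdivrMr ?ltr0n //.
(* Since the measure is at most 1, the factor [1 + e] costs at most [e]. *)
have A1 : vol mu A <= 1 by rewrite -(vol_setT mu); exact: le_vol.
apply: (le_trans le); rewrite mulrAC ler_wpM2r //.
by rewrite mulrDl mul1r lerD2l; rewrite ger_pMr.
Qed.

Lemma motzkin_density_extremal (d1 d2 d3 : G) :
  extremal (set3 d1 d2 d3) (span3 d1 d2 d3) ->
  exists q : rat, motzkin_density mu (set3 d1 d2 d3) = (ratr q)%:E.
Proof.
move=> [gs [c [C [gs0 [P avP cov] pack]]]].
exists (c%:R / (size gs)%:R); rewrite fmorph_div /= !ratr_nat.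
apply/eqP; rewrite eq_le; apply/andP; split.
  apply: ge_ereal_sup => _ [A [mA avA] <-].
  by rewrite volE // lee_fin (vol_le_of_packing gs0 pack).
apply/lee_addgt0Pr => e e0.
have [A [mA avA le]] := exists_dense_avoiding gs0 avP cov e0.
apply: (@le_trans _ _ (mu A + e%:E)%E); first by rewrite volE // -EFinD lee_fin.
by rewrite leeD2r //; apply: ereal_sup_ubound; exists A.
Qed.
End Density.

Theorem theorem1p1 (G : topologicalZmodType) (R : realType)
  (mu : probability (borel G) R) (D : set G) :
  hausdorff_space G -> compact [set: G] -> is_haar_prob mu ->
  (exists s : seq G, (size s <= 3)%N /\ D = [set x | x \in s]) ->
  ~ D 0 ->
  exists q : rat, motzkin_density mu D = (ratr q)%:E.
Proof.
move=> haus comp haar [s [s3 DE]] D0.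
have three d1 d2 d3 : D = set3 d1 d2 d3 ->
    exists q : rat, motzkin_density mu D = (ratr q)%:E.
  move=> E; rewrite E; apply: motzkin_density_extremal => //.
  have DN0 d : D d -> d != 0 by move=> Dd; apply/eqP => d0; rewrite d0 in Dd.
  by apply: extremal_three; apply: DN0; rewrite E /set3 /= !inE eqxx ?orbT.
case: s s3 DE => [|a [|b [|c [|//]]]] _ DE.
(* For empty [D] the whole group is avoiding; one or two elements are padded to three by
   repetition. *)
- exists 1; rewrite rmorph1; apply/eqP; rewrite eq_le; apply/andP; split.
    by apply: ge_ereal_sup => _ [A [mA _] <-]; exact: probability_le1.
  apply: ereal_sup_ubound; exists setT; last exact: probability_setT.
  by split=> [|x y _ _]; [exact: measurableT|rewrite DE].
- apply: (three a a a); rewrite DE; apply/seteqP.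
  by split=> x /=; rewrite /set3 /= !inE !orbb.
- apply: (three a b b); rewrite DE; apply/seteqP.
  by split=> x /=; rewrite /set3 /= !inE !orbb.
- exact: (three a b c).
Qed.
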